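(* Let $X$ be an uncountable Polish space. Then \[ \mathscr{L}_X(\mathrm{FS})=\mathscr{L}_X(\mathcal{H})=\Sigma^1_1(X), \] where $\Sigma^1_1(X)$ is the family of all analytic subsets of $X$. Moreover, for every nonempty analytic set $C\subseteq X$ there exists a sequence $y=(y_n)_{n\in\omega}\in X^\omega$ such that $C=\Lambda_y(\mathrm{FS})=\Lambda_y(\mathcal{H})$.
   Context: $\omega$ denotes the set of nonnegative integers. For infinite $D\subseteq\omega$, $\mathrm{FS}(D)=\{\sum_{n\in\alpha}n:\alpha\subseteq D\text{ finite nonempty}\}$. A set $S\subseteq\omega$ is an IP-set if $\mathrm{FS}(D)\subseteq S$ for some infinite $D\subseteq\omega$. The Hindman ideal is $\mathcal{H}=\{S\subseteq\omega: S\text{ is not an IP-set}\}$. For a sequence $y:\omega\to X$ in a topological space $X$: $\eta\in X$ is an $\mathrm{FS}$-limit (IP-limit) point of $y$ if there is an infinite $D\subseteq\omega$ such that for every neighborhood $U$ of $\eta$ there is a finite $K\subseteq\omega$ with $y_n\in U$ for all $n\in\mathrm{FS}(D\setminus K)$; $\Lambda_y(\mathrm{FS})$ is the set of such points. $\eta$ is an $\mathcal{H}$-limit point of $y$ if there is $E\subseteq\omega$ with $E\notin\mathcal{H}$ such that the subsequence $(y_n)_{n\in E}$ converges to $\eta$ in the ordinary sense; $\Lambda_y(\mathcal{H})$ is the set of such points. $\mathscr{L}_X(\mathrm{FS})=\{A\subseteq X:\exists y\in X^{\omega}\ A=\Lambda_y(\mathrm{FS})\}\cup\{\emptyset\}$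 and $\mathscr{L}_X(\mathcal{H})=\{A\subseteq X:\exists y\in X^{\omega}\ A=\Lambda_y(\mathcal{H})\}\cup\{\emptyset\}$. *)

(* Defs.v *)
From HB Require Import structures.
From mathcomp Require Import all_boot all_order all_algebra.
From mathcomp Require Import all_classical all_reals all_analysis.
From mathcomp Require Import Rstruct Rstruct_topology.
Set Implicit Arguments. Unset Strict Implicit. Unset Printing Implicit Defensive.
Import Order.TTheory GRing.Theory Num.Theory.
Local Open Scope classical_set_scope.
Local Open Scope ring_scope.

Definition is_metric (X : Type) (d : X -> X -> Rdefinitions.R) : Prop :=
  (forall x y, 0 <= d x y) /\ (forall x y, d x y = 0 <-> x = y) /\
  (forall x y, d x y = d y x) /\ (forall x y z, d x z <= d x y + d y z).

Definition metric_generates_topology (X : topologicalType)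
    (d : X -> X -> Rdefinitions.R) : Prop :=
  forall A : set X, open A <->
    (forall x, A x -> exists2 e : Rdefinitions.R, 0 < e & [set y | d x y < e] `<=` A).

Definition metric_complete (X : Type) (d : X -> X -> Rdefinitions.R) : Prop :=
  forall u : nat -> X,
    (forall e : Rdefinitions.R, 0 < e -> exists N, forall m n, (N <= m)%N -> (N <= n)%N -> d (u m) (u n) < e) ->
    exists l : X, forall e : Rdefinitions.R, 0 < e -> exists N, forall n, (N <= n)%N -> d (u n) l < e.

Definition polish_space (X : topologicalType) : Prop :=
  (exists D : set X, countable D /\ dense D) /\
  (exists d : X -> X -> Rdefinitions.R,
      [/\ is_metric d, metric_generates_topology d & metric_complete d]).

(* Baire space omega^omega with the product topology (nat discrete). *)
Definition baire_space := {ptws nat -> nat}.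

Definition analytic (X : topologicalType) (A : set X) : Prop :=
  A = set0 \/ exists f : baire_space -> X, continuous f /\ f @` setT = A.

Definition FS (D : set nat) : set nat :=
  [set n | exists s : seq nat, [/\ uniq s, s != [::], (forall i, i \in s -> D i)
                                 & n = (\sum_(i <- s) i)%N]].

Definition IP_set (S : set nat) : Prop :=
  exists D : set nat, infinite_set D /\ FS D `<=` S.

Definition Hindman : set (set nat) := [set S | ~ IP_set S].

Definition FS_limits (X : topologicalType) (y : nat -> X) : set X :=
  [set eta | exists D : set nat, infinite_set D /\
     forall U : set X, nbhs eta U ->
       exists K : set nat, finite_set K /\ forall n, FS (D `\` K) n -> U (y n)].

Definition H_limits (X : topologicalType) (y : nat -> X) : set X :=
  [set eta | exists E : set nat, ~ Hindman E /\
     forall U : set X, nbhs eta U -> finite_set [set n | E n /\ ~ U (y n)]].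

Definition L_FS (X : topologicalType) : set (set X) :=
  [set A | (exists y : nat -> X, A = FS_limits y) \/ A = set0].

Definition L_H (X : topologicalType) : set (set X) :=
  [set A | (exists y : nat -> X, A = H_limits y) \/ A = set0].

Definition Sigma11 (X : topologicalType) : set (set X) := [set A | analytic A].

Arguments L_FS X : clear implicits.
Arguments L_H X : clear implicits.
Arguments Sigma11 X : clear implicits.

(* Main.v *)
Require Import Defs.
From HB Require Import structures.
From mathcomp Require Import all_boot all_order all_algebra.
From mathcomp Require Import all_classical all_reals all_analysis.
From mathcomp Require Import Rstruct Rstruct_topology zify lra.
Local Open Scope classical_set_scope.
Set Implicit Arguments. Unset Strict Implicit. Unset Printing Implicit Defensive.
Import Order.TTheory GRing.Theory Num.Theory.

(** Both kinds of limit points are limits along strictly increasing sequences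
    [e] with a prescribed rate of convergence on finite sums of [e]. Since the
    metric is complete, such [e] form a closed subset of Baire space on which
    the limit is a continuous function, so the limit sets are analytic.

    Conversely let [C] be the image of a continuous [f] on Baire space. Read the
    lowest and highest binary digit positions of [n] as codes of finite
    sequences [a n] and [b n]; put [y n = f (b n 0 0 ...)] when [a n] is a prefix
    of [b n], and [y n = f (0 0 ...)] otherwise. For a branch [x], [y] tends to
    [f x] along the finite sums of the numbers [2 ^ code (x|k)]. On the other
    hand every [FS D] contains sums [u 0, u 1, ...] of disjoint sets with [u k.+1]
    divisible by [2 ^ (u k).+1]. If [a n] is a prefix of [b n] for all [n] in a
    tail of [FS D], then taking [n = u i + u j] with [i < j] shows that [a (u i)]
    is a prefix of [b (u j)], so the [b (u j)] converge to a branch [x] and the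
    limit is [f x]; otherwise the limit is [f (0 0 ...)]. *)

(** * Sets of naturals and neighborhoods in Baire space *)

Lemma finite_natP (A : set nat) :
  finite_set A <-> exists N, forall n, A n -> (n < N)%N.
Proof.
split=> [/finite_seqP[s ->]|[N AN]].
  exists (\max_(i <- s) i).+1 => n /= ns.
  by rewrite ltnS; apply: (@leq_bigmax_seq _ _ xpredT id).
by apply: (@sub_finite_set _ _ `I_N) => //; exact: finite_II.
Qed.

Lemma infinite_natP (A : set nat) :
  infinite_set A <-> forall N, exists2 n, A n & (N <= n)%N.
Proof.
split=> [infA N|cofA /finite_natP[N AN]].
  apply: contrapT => noA; apply: infA; apply/finite_natP; exists N => n An.
  by rewrite ltnNge; apply/negP => Nn; apply: noA; exists n.
by have [n An] := cofA N; rewrite leqNgt AN.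
Qed.

(** If no [N] works, points off [U] agreeing with [x] ever longer converge pointwise to [x].
    Conversely, the cylinder of length [N] is cut out by [N] coordinate conditions, added one at a
    time. *)
Lemma nbhs_baireP (x : baire_space) (U : set baire_space) :
  nbhs x U <->
  exists N, forall z : baire_space, (forall i, (i < N)%N -> z i = x i) -> U z.
Proof.
split=> [xU|[N NU]].
  apply: contrapT => noN.
  have /choice[z zP] N : exists z : baire_space,
      (forall i, (i < N)%N -> z i = x i) /\ ~ U z.
    apply: contrapT => noz; apply: noN; exists N => z zx.
    by apply: contrapT => nUz; apply: noz; exists z.
  have zx : z @ \oo --> x.
    apply/(@pointwise_cvgP nat nat) => t A /nbhs_singleton At.
    exists t.+1 => // n /= tn; rewrite /= (proj1 (zP n)) //.
  have [N _ /(_ N (leqnn N))] := zx _ xU.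
  exact: (proj2 (zP N)).
elim: N U NU => [|N IHN] U NU; first by apply: filterS filterT => z _; exact: NU.
have /IHN : forall z : baire_space, (forall i, (i < N)%N -> z i = x i) ->
    [set z | z N = x N -> U z] z.
  move=> z zx /= zN; apply: NU => i; rewrite ltnS leq_eqVlt => /predU1P[->//|].
  exact: zx.
have : nbhs x ((fun z : baire_space => z N) @^-1` [set x N]).
  exact: (@proj_continuous nat (fun=> nat) N x _ (discrete_set1 _)).
apply: filterS2 => z /= zN; exact.
Qed.

(** * Lowest and highest binary digits of sums *)

Lemma sum_pow2_lt (M : nat) (t : seq nat) :
  path gtn M t -> (\sum_(e <- t) 2 ^ e < 2 ^ M)%N.
Proof.
elim: t M => [|e t IHt] M /=; first by rewrite big_nil expn_gt0.
move=> /andP[eM /IHt te]; rewrite big_cons.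
apply: (@leq_trans (2 ^ e.+1)); last by rewrite leq_exp2l.
by rewrite expnS mul2n -addnn ltn_add2l.
Qed.

Lemma trunc_log_sum_pow2 (t : seq nat) : uniq t -> t != [::] ->
  trunc_log 2 (\sum_(e <- t) 2 ^ e)%N \in t.
Proof.
move=> ut t0; have pt := permEl (perm_sort geq t).
rewrite -(perm_big _ pt) -(perm_mem pt) /=.
have : sorted gtn (sort geq t).
  by rewrite gtn_sorted_uniq_geq sort_uniq ut; apply: sort_sorted => m n; lia.
have : sort geq t != [::] by rewrite -size_eq0 size_sort size_eq0.
case: (sort geq t) => //= e s _ /sum_pow2_lt se.
rewrite big_cons (@trunc_log_eq 2 e) ?mem_head// leq_addr /=.
by rewrite expnS mul2n -addnn ltn_add2l.
Qed.

Lemma logn2D (m n : nat) : (0 < m)%N -> (2 ^ (logn 2 m).+1 %| n)%N ->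
  logn 2 (m + n) = logn 2 m.
Proof.
move=> m0 dn; apply/eqP; rewrite eqn_leq.
have mn0 : (0 < m + n)%N by rewrite addn_gt0 m0.
apply/andP; split.
  rewrite leqNgt -(pfactor_dvdn (p := 2))// dvdn_addl//.
  by rewrite (pfactor_dvdn (p := 2))// ltnn.
rewrite -(pfactor_dvdn (p := 2))// dvdn_add ?pfactor_dvdnn//.
by apply: dvdn_trans dn; rewrite dvdn_exp2l.
Qed.

Lemma logn_sum_pow2 (t : seq nat) : uniq t -> t != [::] ->
  logn 2 (\sum_(e <- t) 2 ^ e)%N \in t.
Proof.
move=> ut t0; have pt := permEl (perm_sort leq t).
rewrite -(perm_big _ pt) -(perm_mem pt) /=.
have : sorted ltn (sort leq t).
  by rewrite ltn_sorted_uniq_leq sort_uniq ut; apply: sort_sorted => m n; lia.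
have : sort leq t != [::] by rewrite -size_eq0 size_sort size_eq0.
case: (sort leq t) => //= e s _ /(order_path_min ltn_trans)/allP se.
rewrite big_cons logn2D ?expn_gt0// pfactorK// ?mem_head//.
by rewrite big_seq; apply: dvdn_sum => i /se ei; rewrite dvdn_exp2l.
Qed.

(** Distinct powers of two add without carries, so the extreme digit positions are exponents of the
    summands. *)
Lemma FS_pow2 (P : set nat) n : FS [set (2 ^ e)%N | e in P] n ->
  P (logn 2 n) /\ P (trunc_log 2 n).
Proof.
move=> [s [us s0 sP ->]]; pose t := map (trunc_log 2) s.
have sE : s = map (expn 2) t.
  rewrite -map_comp -[LHS]map_id; apply/eq_in_map => i /sP[e _ <-] /=.
  by rewrite trunc_expnK.
have ut : uniq t by apply: (@map_uniq _ _ (expn 2)); rewrite -sE.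
have t0 : t != [::] by rewrite -size_eq0 size_map size_eq0.
have tP e : e \in t -> P e.
  by move=> /mapP[i /sP[e' Pe' <-] ->]; rewrite trunc_expnK.
rewrite sE big_map; split; apply: tP.
  exact: logn_sum_pow2.
exact: trunc_log_sum_pow2.
Qed.

(** Since [m < 2 ^ m.+1], adding [m] to a multiple of [2 ^ m.+1] leaves all digits above position
    [m] unchanged. *)
Lemma trunc_log2D (m n : nat) : (0 < n)%N -> (2 ^ m.+1 %| n)%N ->
  trunc_log 2 (m + n) = trunc_log 2 n.
Proof.
move=> n0 /dvdnP[q nE]; have q0 : (0 < q)%N by move: n0; rewrite nE; case: q {nE}.
have /andP[tn nt] := trunc_log_bounds (isT : (1 < 2)%N) n0.
set t := trunc_log 2 n in tn nt *.
have m2 : (m < 2 ^ m.+1)%N by rewrite (ltn_trans (ltnSn m))// ltn_expl.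
have mt : (m.+1 <= t.+1)%N.
  rewrite -(@leq_exp2l 2)//; apply: leq_trans (ltnW nt).
  by rewrite nE leq_pmull.
apply: trunc_log_eq => //; rewrite (leq_trans tn) ?leq_addl//=.
move: nt; rewrite nE -(subnKC mt) expnD mulnC ltn_pmul2l ?expn_gt0// => qt.
apply: (@leq_trans (2 ^ m.+1 * q.+1)); first by rewrite mulnS ltn_add2r.
by rewrite leq_pmul2l ?expn_gt0.
Qed.

(** * Finite sums over infinite sets *)

Lemma FS_subset (D D' : set nat) : D `<=` D' -> FS D `<=` FS D'.
Proof. by move=> DD' n [s [us s0 sD ->]]; exists s; split=> // i /sD/DD'. Qed.

Lemma FS_ge (D : set nat) (N n : nat) : FS (D `\` `I_N) n -> (N <= n)%N.
Proof.
move=> [[|i s] [_ // _ /(_ i (mem_head _ _))[_ /= iN] ->]].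
by rewrite big_cons; move/negP: iN; lia.
Qed.

(** Every summand of [m] is at most [m], so the two lists of summands are disjoint. *)
Lemma FS_add (D : set nat) (m n : nat) :
  FS D m -> FS (D `\` `I_m.+1) n -> FS D (m + n).
Proof.
move=> [s [us s0 sD mE]] [r [ur r0 rD nE]]; exists (s ++ r); split.
- rewrite cat_uniq us ur andbT /=; apply/hasPn => i /rD[_ im].
  apply/negP => is_; apply: im => /=.
  by rewrite ltnS mE (big_rem _ is_) /= leq_addr.
- by case: s s0 {us sD mE}.
- by move=> i; rewrite mem_cat => /orP[/sD//|/rD[]].
- by rewrite big_cat /= mE nE.
Qed.

Lemma infinite_setD_II (D : set nat) (N : nat) :
  infinite_set D -> infinite_set (D `\` `I_N).
Proof.
move=> /infinite_natP infD; apply/infinite_natP => M.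
have [n Dn] := infD (maxn M N); rewrite geq_max => /andP[Mn Nn].
by exists n => //; split => //=; apply/negP; rewrite -leqNgt.
Qed.

Lemma infinite_set_uniq_seq (A : set nat) (k : nat) : infinite_set A ->
  exists s : seq nat, [/\ uniq s, size s = k & forall i, i \in s -> A i].
Proof.
move=> /infinite_natP infA; elim: k => [|k [s [us sk sA]]]; first by exists [::].
have [n An sn] := infA (\max_(i <- s) i).+1.
exists (n :: s); split => /=; last by move=> i /[!inE]/predU1P[->//|/sA].
- rewrite us andbT; apply/negP => ns.
  have := @leq_bigmax_seq _ s xpredT id n ns isT.
  by rewrite leqNgt sn.
- by rewrite sk.
Qed.

(* Sum [q] distinct elements of [D] lying in a common residue class. *)
Lemma FS_dvdn (D : set nat) (q : nat) : infinite_set D -> (0 < q)%N ->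
  exists2 n, FS D n & (q %| n)%N.
Proof.
move=> infD q0.
have [r infr] : exists r, infinite_set [set n | D n /\ n %% q = r].
  apply: contrapT => /forallNP finr; apply: infD.
  have finU : finite_set (\bigcup_(r in `I_q) [set n | D n /\ n %% q = r]).
    by apply: bigcup_finite (finite_II q) _ => r _; exact: contrapT (finr r).
  by apply: sub_finite_set finU => n Dn; exists (n %% q)%N => //; exact: ltn_pmod.
have [s [us sq sr]] := infinite_set_uniq_seq q infr.
exists (\sum_(i <- s) i)%N.
  exists s; split=> //; first by rewrite -size_eq0 sq -lt0n.
  by move=> i /sr[].
rewrite /dvdn -modn_summ big_seq (eq_bigr (fun=> r)); last by move=> i /sr[].
by rewrite -big_seq big_const_seq count_predT sq iter_addn_0 modnMl.
Qed.

(** * Codes of finite sequences and limits of the coded sequence *)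

Lemma code_rcons_lt (s : seq nat) (x : nat) :
  (CodeSeq.code s < CodeSeq.code (rcons s x))%N.
Proof.
elim: s => [|a s IHs] /=; first by rewrite muln_gt0 expn_gt0.
by rewrite ltn_pmul2l ?expn_gt0// ltnS ltn_double.
Qed.

Lemma code_mkseq_lt (x : nat -> nat) :
  {homo (fun k => CodeSeq.code (mkseq x k)) : i j / (i < j)%N}.
Proof.
apply: homo_ltn => [? ? ?|k]; first exact: ltn_trans.
by rewrite mkseqS code_rcons_lt.
Qed.

Lemma code_mkseq_le (x : nat -> nat) (i j : nat) :
  (CodeSeq.code (mkseq x i) <= CodeSeq.code (mkseq x j))%N = (i <= j)%N.
Proof. exact: (leq_mono (@code_mkseq_lt x)). Qed.

Lemma prefix_mkseq (x : nat -> nat) (i j : nat) : (i <= j)%N ->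
  prefix (mkseq x i) (mkseq x j).
Proof. by move=> ij; rewrite prefixE size_mkseq /mkseq -map_take take_iota (minn_idPl ij). Qed.

Definition pad (s : seq nat) : baire_space := nth 0%N s.

Definition coherent (n : nat) : bool :=
  prefix (CodeSeq.decode (logn 2 n)) (CodeSeq.decode (trunc_log 2 n)).

Definition coded_seq (X : Type) (f : baire_space -> X) (n : nat) : X :=
  f (pad (if coherent n then CodeSeq.decode (trunc_log 2 n) else [::])).

Lemma logn_le_trunc_log (n : nat) : (0 < n)%N -> (logn 2 n <= trunc_log 2 n)%N.
Proof.
move=> n0; rewrite -ltnS -(@ltn_exp2l 2)//.
by apply: leq_ltn_trans (trunc_log_ltn _ _) => //; rewrite dvdn_leq ?pfactor_dvdnn.
Qed.

Lemma H_limits_coded_seq (X : topologicalType) (f : baire_space -> X)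
  (x : baire_space) : continuous f -> H_limits (coded_seq f) (f x).
Proof.
move=> cf; pose c k := CodeSeq.code (mkseq x k).
pose D := [set (2 ^ e)%N | e in range c].
have cK k : CodeSeq.decode (c k) = mkseq x k by exact: CodeSeq.codeK.
exists (FS D); split.
  move=> nIP; apply: nIP; exists D; split=> //.
  apply/infinite_natP => N; exists (2 ^ c N)%N; first by exists (c N) => //; exists N.
  apply: (@leq_trans (c N)); last exact/ltnW/ltn_expl.
  by elim: N => // N /leq_ltn_trans; apply; exact: code_mkseq_lt.
move=> U /(cf x)/nbhs_baireP[N NU]; apply/finite_natP.
(* Numbers above this bound have their highest digit at some [c j] with [N < j], so they decode to a
   prefix of [x] longer than [N]. *)
exists (2 ^ (c N).+1)%N => n [nD nU].
have [[i _ iE] [j _ jE]] := FS_pow2 nD.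
apply: (@leq_trans (2 ^ (trunc_log 2 n).+1)); first exact: trunc_log_ltn.
rewrite leq_exp2l// ltnS -jE code_mkseq_le leqNgt; apply/negP => Nj; apply: nU.
(* [trunc_log 2 0] is 0 by convention, whereas [c j] exceeds [c N]. *)
have n0 : (0 < n)%N.
  rewrite lt0n; apply/eqP => n0; move: jE; rewrite n0 trunc_log0 => j0.
  by have := code_mkseq_lt x Nj; rewrite -/(c j) j0.
have ij : (i <= j)%N.
  by rewrite -(code_mkseq_le x) -/(c i) -/(c j) iE jE logn_le_trunc_log.
rewrite /coded_seq /coherent -iE -jE !cK prefix_mkseq//.
by apply: NU => k kN; rewrite /pad nth_mkseq// (ltn_trans kN).
Qed.

Lemma FS_limits_coded_seq (X : topologicalType) (f : baire_space -> X) :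
  hausdorff_space X -> continuous f -> FS_limits (coded_seq f) `<=` range f.
Proof.
move=> hX cf eta [D [infD Deta]].
have {}Deta U : nbhs eta U ->
    exists N, forall n, FS (D `\` `I_N) n -> U (coded_seq f n).
  move=> /Deta[K [/finite_natP[N KN] KU]]; exists N => n nN; apply: KU.
  by apply: FS_subset nN => i [Di iN]; split=> // /KN.
have [[N0 coh]|incoh] := pselect (exists N, forall n, FS (D `\` `I_N) n -> coherent n);
    last first.
  (* Every tail of [FS D] contains an incoherent number, where the value is [f (pad [::])]; so this
     value lies in every neighborhood of [eta]. *)
  exists (pad [::]) => //; apply/esym/hX => U V Ueta /nbhs_singleton V0.
  have [N NU] := Deta _ Ueta; exists (f (pad [::])); split=> //.
  apply: contrapT => nU; apply: incoh; exists N => n /NU.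
  by rewrite /coded_seq; case: ifP.
have /choice[g gP] L : exists n, FS (D `\` `I_L) n /\ (2 ^ L %| n)%N.
  have L0 : (0 < 2 ^ L)%N by rewrite expn_gt0.
  have [n nD Ln] := FS_dvdn (@infinite_setD_II D L infD) L0.
  by exists n.
(* The argument [n.+1] makes all summands of the next term exceed the current term; starting at
   [N0.+1] rather than [N0] makes [u 0] positive. *)
pose u k := iter k (fun n => g n.+1) (g N0.+1).
have uS k : (u k < u k.+1)%N by exact: FS_ge (proj1 (gP (u k).+1)).
have u_mono : {homo u : i j / (i < j)%N}.
  by apply: homo_ltn => // ? ? ?; exact: ltn_trans.
have u_gt0 k : (0 < u k)%N.
  by case: k => [|k]; [exact: leq_trans (FS_ge (proj1 (gP N0.+1)))|exact: leq_ltn_trans (uS k)].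
have u_ge k : (k <= u k)%N by elim: k => // k /leq_ltn_trans; apply.
have u_FS i j : (i < j)%N -> FS (D `\` `I_(u i).+1) (u j).
  case: j => // j; rewrite ltnS => ij.
  apply: FS_subset (proj1 (gP (u j).+1)) => n [Dn nj]; split=> //= ni.
  apply: nj => /=; apply: leq_trans ni _; rewrite ltnS.
  exact: (ltnW_homo u_mono).
have u_dvd i j : (i < j)%N -> (2 ^ (u i).+1 %| u j)%N.
  case: j => // j; rewrite ltnS => ij; apply: dvdn_trans (proj2 (gP (u j).+1)).
  by rewrite dvdn_exp2l// ltnS (ltnW_homo u_mono).
have u_FS0 k : FS (D `\` `I_N0) (u k).
  have u0 : FS (D `\` `I_N0) (u 0).
    by apply: FS_subset (proj1 (gP N0.+1)) => n [Dn nN]; split=> //= /ltnW.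
  case: k => // k; apply: FS_subset (u_FS 0%N k.+1 isT) => n [Dn nu]; split=> //= nN.
  by apply: nu => /=; apply: leq_trans nN _; exact/leqW/FS_ge/u0.
pose a k := CodeSeq.decode (logn 2 (u k)).
pose b k := CodeSeq.decode (trunc_log 2 (u k)).
have logu i : (logn 2 (u i) <= u i)%N by apply/ltnW/ltn_logl.
(* The sum [u i + u j] has the lowest digit of [u i] and the highest digit of [u j], and it is
   coherent. *)
have ab i j : (i < j)%N -> prefix (a i) (b j).
  move=> ij; have := coh (u i + u j)%N; rewrite /coherent logn2D//; last first.
    by apply: dvdn_trans (u_dvd _ _ ij); rewrite dvdn_exp2l// ltnS logu.
  rewrite trunc_log2D ?u_dvd//; apply; apply: FS_add (u_FS0 i) _.
  rewrite setDDl; apply: FS_subset (u_FS _ _ ij) => n [Dn nu]; split=> // -[/= nN|//].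
  by apply: nu => /=; apply: leq_trans nN _; exact/leqW/FS_ge/u_FS0.
have a_inj : injective a.
  have lm : {homo (fun k => logn 2 (u k)) : i j / (i < j)%N}.
    apply: homo_ltn => [? ? ?|k]; first exact: ltn_trans.
    apply: leq_ltn_trans (logu k) _.
    by rewrite -(pfactor_dvdn (p := 2)) ?u_dvd.
  move=> i j /(can_inj CodeSeq.decodeK).
  exact: (incn_inj (leq_mono lm)).
(* Pigeonhole: [a 0], ..., [a N.+1] are distinct prefixes of [b N.+2], so their [N.+2] lengths are
   distinct and cannot all be at most [N]. *)
have /choice[I IP] N : exists i, (N < size (a i))%N.
  apply: contrapT => /forallNP small.
  have : (size (map (size \o a) (iota 0 N.+2)) <= size (iota 0 N.+1))%N.
    apply: uniq_leq_size => [|_ /mapP[i _ ->]].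
      rewrite map_inj_in_uniq ?iota_uniq// => i j.
      rewrite !mem_iota /= => iN jN; move: (ab i N.+2 iN) (ab j N.+2 jN).
      by rewrite !prefixE /= => /eqP ai /eqP aj sij; apply: a_inj; rewrite -ai -aj sij.
    by rewrite mem_iota /= ltnS leqNgt; apply/negP/small.
  by rewrite size_map !size_iota ltnn.
(* [a (I N)] is long enough to have an entry [N], and as a prefix of every later [b j] it fixes that
   entry there. *)
pose x : baire_space := fun N => nth 0%N (a (I N)) N.
have bx N j : (I N < j)%N -> pad (b j) N = x N.
  by move=> /ab/prefixP[s bE]; rewrite /pad bE nth_cat IP.
exists x => //; apply/esym/hX => U V /Deta[N NU] /(cf x)/nbhs_baireP[M MV].
(* The first bound puts [u j] in the tail of [FS D] beyond [N]; the second makes [b j] agree with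
   [x] below [M]. *)
pose j := (maxn N (\max_(n < M) (I n)).+1).+1.
have uj : coded_seq f (u j) = f (pad (b j)) by rewrite /coded_seq coh.
exists (f (pad (b j))); split; last first.
  apply: MV => i iM; apply: bx; rewrite /j ltnS leq_max; apply/orP; right.
  by rewrite leqW// (leq_bigmax (F := fun n : 'I_M => I n) (Ordinal iM)).
rewrite -uj; apply: NU; apply: FS_subset (u_FS j.-1 j _) => // n [Dn nu].
split=> //= nN; apply: nu => /=; apply: leq_trans nN _.
by apply: leqW; apply: leq_trans (u_ge _); rewrite /j /= leq_maxl.
Qed.

(** * Metric neighborhoods and images of closed subsets of Baire space *)

Lemma nbhs_metricP (X : topologicalType) (d : X -> X -> Rdefinitions.R) :
  is_metric d -> metric_generates_topology d -> forall (x : X) (U : set X),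
  nbhs x U <->
  exists2 e : Rdefinitions.R, (0 < e)%R & [set y | (d x y < e)%R] `<=` U.
Proof.
move=> [d_ge0 [d0 [dC dT]]] dtop x U; split.
  rewrite nbhsE => -[A [/dtop oA Ax] AU]; have [e e0 eA] := oA _ Ax.
  by exists e => // y /eA/AU.
move=> [e e0 eU]; rewrite nbhsE; exists [set y | (d x y < e)%R] => //; split.
  apply/dtop => y /= xy; exists (e - d x y)%R; first by lra.
  by move=> z /= yz; have := dT x y z; lra.
by rewrite /= (proj2 (d0 x x)).
Qed.

Lemma metric_hausdorff (X : topologicalType) (d : X -> X -> Rdefinitions.R) :
  is_metric d -> metric_generates_topology d -> hausdorff_space X.
Proof.
move=> md dtop; have nb := nbhs_metricP md dtop.
move: md => [d_ge0 [d0 [dC dT]]] x y xy.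
have [//|nxy] := pselect (x = y).
have dxy : (0 < d x y)%R.
  by rewrite lt_neqAle d_ge0 andbT eq_sym; apply/eqP => /d0.
have ball_nbhs z : nbhs z [set w | (d z w < d x y / 2)%R].
  by apply/nb; exists (d x y / 2)%R => //; lra.
have [z [/= xz yz]] := xy _ _ (ball_nbhs x) (ball_nbhs y).
by exfalso; clear nxy; have := dT x z y; rewrite (dC z y); lra.
Qed.

(* [P] is a retract of Baire space: a point off [P] is sent to a point of [P]
   chosen from its longest prefix that has an extension in [P]. *)
Lemma analytic_closed_image (X : topologicalType) (P : set baire_space)
    (phi : baire_space -> X) :
  closed P -> {within P, continuous phi} -> analytic (phi @` P).
Proof.
move=> clP /subspace_continuousP cphi.
have [->|/set0P[p0 Pp0]] := eqVneq P set0; first by left; rewrite image_set0.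
right.
pose ext (z : baire_space) N :=
  exists2 p : baire_space, P p & forall i, (i < N)%N -> p i = z i.
have extW z M N : (M <= N)%N -> ext z N -> ext z M.
  by move=> MN [p Pp pz]; exists p => // i iM; apply: pz; exact: leq_trans MN.
have ext_agree z z' N : (forall i, (i < N)%N -> z' i = z i) -> ext z N -> ext z' N.
  by move=> zz' [p Pp pz]; exists p => // i iN; rewrite pz// zz'.
(* Choosing the extension from the finite sequence alone makes the retraction depend only on a
   prefix. *)
have /choice[c cP] (s : seq nat) : exists p : baire_space, P p /\
    forall z N, s = mkseq z N -> ext z N -> forall i, (i < N)%N -> p i = z i.
  have [[z [N [-> [p Pp pz]]]]|nos] :=
      pselect (exists z N, s = mkseq z N /\ ext z N).
    exists p; split=> // z' N' zz' _ i iN'.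
    have NN' : N = N' by rewrite -(size_mkseq z N) zz' size_mkseq.
    by subst N'; rewrite pz// -(nth_mkseq 0%N z iN') zz' nth_mkseq.
  by exists p0; split=> // z N sz zN; exfalso; apply: nos; exists z, N.
have /choice[L LP] z : exists N, ~ P z -> ext z N /\ ~ ext z N.+1.
  have [Pz|nPz] := pselect (P z); first by exists 0%N.
  apply: contrapT => noN.
  have extz N : ext z N.
    elim: N => [|N IHN]; first by exists p0.
    by apply: contrapT => nN; apply: noN; exists N.
  apply: nPz; apply: clP => U /nbhs_baireP[N NU].
  by have [p Pp pz] := extz N; exists p; split=> //; exact: NU.
pose r z := if pselect (P z) then z else c (mkseq z (L z)).
have Pr z : P (r z) by rewrite /r; case: pselect => //= _; exact: (proj1 (cP _)).
exists (phi \o r); split; last first.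
  apply/seteqP; split=> [_ [z _ <-]|_ [p Pp <-]] /=; first by exists (r z).
  by exists p => //=; rewrite /r; case: pselect.
(* Near a point [z] of [P], points share a long prefix with [z], hence so do their images under [r].
   Off [P], agreement with [z] below [(L z).+1] forces the same [L] and the same [r]: there [r] is
   locally constant. *)
move=> z U; have [Pz|nPz] := pselect (P z).
  have rz : r z = z by rewrite /r; case: pselect.
  rewrite /= rz => /(cphi z Pz) /nbhs_baireP[M MU]; apply/nbhs_baireP.
  exists M => z' zz'; apply: MU (Pr z') => i iM.
  rewrite /r; case: pselect => /= [_|nPz']; first exact: zz'.
  have [extL nextL] := LP _ nPz'.
  have ML : (M <= L z')%N.
    rewrite leqNgt; apply/negP => LM; apply: nextL; apply: extW LM _.
    by exists z => // j jM; rewrite zz'.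
  by rewrite (proj2 (cP _) z' (L z')) ?zz'// (leq_trans iM).
move=> /nbhs_singleton Uz; have [extL nextL] := LP _ nPz.
apply/nbhs_baireP; exists (L z).+1 => z' zz'.
have nextL' : ~ ext z' (L z).+1.
  by move=> /ext_agree e; apply: nextL; apply: e => i iL; rewrite zz'.
have nPz' : ~ P z' by move=> Pz'; apply: nextL'; exists z'.
have extL' : ext z' (L z) by apply: ext_agree extL => i iL; rewrite zz'// leqW.
have [extL2 nextL2] := LP _ nPz'.
have LL : L z' = L z.
  apply/eqP; rewrite eqn_leq; apply/andP; split; rewrite leqNgt; apply/negP => LL.
    by apply: nextL'; exact: extW extL2.
  by apply: nextL2; exact: extW extL'.
suff rE : r z' = r z by change (U (phi (r z'))); rewrite rE.
rewrite /r; case: pselect => //= _; case: pselect => //= _; rewrite LL.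
congr (c _); apply/eq_in_map => i; rewrite mem_iota /= add0n => iL.
by rewrite zz'// leqW.
Qed.

(** * Limits along finite sums with a prescribed rate *)

Definition rate (k : nat) : Rdefinitions.R := (k.+1%:R^-1)%R.

Lemma rate_gt0 (k : nat) : (0 < rate k)%R.
Proof. by rewrite invr_gt0 ltr0n. Qed.

Lemma rate_lt (e : Rdefinitions.R) : (0 < e)%R -> exists k, (rate k < e)%R.
Proof.
move=> e0; have [N _ NP] := near_infty_natSinv_lt (PosNum e0).
by exists N; exact: (NP N (leqnn N)).
Qed.

(** [F] lists indices into [e], and [Q F k] selects the sums that must be within [rate k]; the two
    notions of limit point differ only in [Q]. The non-strict bound passes to limits in [e]. *)
Definition sum_rate (X : Type) (d : X -> X -> Rdefinitions.R) (y : nat -> X)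
    (Q : seq nat -> nat -> Prop) (e : baire_space) (eta : X) : Prop :=
  forall (k : nat) (F : seq nat), Q F k ->
    (d (y (\sum_(i <- F) e i)%N) eta <= rate k)%R.

Definition sum_limits (X : Type) (d : X -> X -> Rdefinitions.R) (y : nat -> X)
    (Q : seq nat -> nat -> Prop) : set X :=
  [set eta | exists2 e : baire_space,
     {homo e : i j / (i < j)%N} & sum_rate d y Q e eta].

(** Singletons in [Q] bound the distance from [y (e k)] to the limit by [rate k]. Hence the entry
    [e k] alone determines the limit up to twice [rate k], which gives uniqueness and continuity. *)
Lemma analytic_sum_limits (X : topologicalType) (d : X -> X -> Rdefinitions.R)
    (y : nat -> X) (Q : seq nat -> nat -> Prop) :
  is_metric d -> metric_generates_topology d -> metric_complete d ->
  (forall k j, (k <= j)%N -> Q [:: j] k) -> analytic (sum_limits d y Q).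
Proof.
move=> md dtop dcomp Q1; have nb := nbhs_metricP md dtop.
have [d_ge0 [d0 [dC dT]]] := md.
have rate1 e eta k j : (k <= j)%N -> sum_rate d y Q e eta ->
    (d (y (e j)) eta <= rate k)%R.
  by move=> kj /(_ k [:: j] (Q1 _ _ kj)); rewrite big_seq1.
have uniq_eta e e' eta eta' k : e k = e' k ->
    sum_rate d y Q e eta -> sum_rate d y Q e' eta' ->
    (d eta eta' <= rate k + rate k)%R.
  move=> ek /(rate1 _ _ k k (leqnn k)) h /(rate1 _ _ k k (leqnn k)).
  by rewrite -ek => h'; have := dT eta (y (e k)) eta'; rewrite (dC eta (y _)); lra.
have [->|/set0P[eta0 _]] := eqVneq (sum_limits d y Q) set0; first by left.
pose P := [set e : baire_space | {homo e : i j / (i < j)%N} /\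
  exists eta, sum_rate d y Q e eta].
have /choice[phi phiP] e : exists eta, P e -> sum_rate d y Q e eta.
  have [[_ [eta]]|nPe] := pselect (P e); first by exists eta.
  by exists eta0.
have -> : sum_limits d y Q = phi @` P.
  apply/seteqP; split=> [eta [e me re]|_ [e Pe <-]]; last first.
    by exists e; [case: Pe|exact: phiP].
  have Pe : P e by split => //; exists eta.
  exists e => //; apply/d0/eqP; rewrite eq_le d_ge0 andbT leNgt; apply/negP => dpos.
  have half0 : (0 < d (phi e) eta / 2)%R by lra.
  have [k kP] := rate_lt half0.
  by have := uniq_eta e e (phi e) eta k erefl (phiP _ Pe) re; lra.
apply: analytic_closed_image; last first.
  apply/subspace_continuousP => e Pe U /nb[r r0 rU].
  have half0 : (0 < r / 2)%R by lra.
  have [k kP] := rate_lt half0.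
  apply/nbhs_baireP; exists k.+1 => e' ee' Pe'; apply: rU => /=.
  by have := uniq_eta e e' _ _ k (esym (ee' k (ltnSn k))) (phiP _ Pe) (phiP _ Pe'); lra.
move=> e clPe.
have approx M : exists e', [/\ {homo e' : i j / (i < j)%N},
    (exists eta, sum_rate d y Q e' eta) & forall i, (i < M)%N -> e' i = e i].
  have [|e' [[me' re'] ee']] := clPe [set z | forall i, (i < M)%N -> z i = e i].
    by apply/nbhs_baireP; exists M.
  by exists e'.
split=> [i j ij|].
  have [e' [me' _ ee']] := approx j.+1.
  by rewrite -!ee' ?me'// (ltn_trans ij).
(* Any two terms also occur along some [e'] in [P], whose limit is near both; so the sequence is
   Cauchy. *)
have [r r0|eta etaP] := dcomp (fun j => y (e j)).
  have half0 : (0 < r / 2)%R by lra.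
  have [k kP] := rate_lt half0.
  exists k => m n km kn.
  have [e' [_ [eta re'] ee']] := approx (maxn m n).+1.
  have := rate1 _ _ _ _ km re'; have := rate1 _ _ _ _ kn re'.
  rewrite !ee' ?ltnS ?leq_maxl ?leq_maxr//.
  by have := dT (y (e m)) eta (y (e n)); rewrite (dC eta); lra.
exists eta => k F QF; rewrite leNgt; apply/negP => far.
set dF := d _ _ in far; set q := rate k in far.
(* Take [e'] in [P] agreeing with [e] on [F] and at a late index [j]. Its limit and [eta] each lie
   within half the excess of [y (e j)], so the bound for [e'] contradicts [far]. *)
have gap : (0 < (dF - q) / 2)%R by lra.
have [N NP] := etaP _ gap; have [m mP] := rate_lt gap.
pose j := maxn N m.
have [e' [_ [eta' re'] ee']] := approx (maxn j (\max_(i <- F) i)).+1.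
have := re' k F QF; rewrite (eq_big_seq e) => [dF'|i iF]; last first.
  rewrite ee'// ltnS leq_max; apply/orP; right.
  exact: (@leq_bigmax_seq _ _ xpredT id).
have := rate1 _ _ m j (leq_maxr _ _) re'; rewrite ee' ?ltnS ?leq_maxl// => dj.
have := NP j (leq_maxl _ _) => djeta.
have := dT (y (\sum_(i <- F) e i)%N) eta' eta; have := dT eta' (y (e j)) eta.
by rewrite (dC eta' (y _)) -/dF; move: dF' dj; rewrite -/q; lra.
Qed.

(** * Both kinds of limit points as limits with a rate *)

Lemma thin_subsequence (D : set nat) (N : nat -> nat) : infinite_set D ->
  exists e : nat -> nat, [/\ {homo e : i j / (i < j)%N}, forall k, D (e k)
                           & forall k, (N k <= e k)%N].
Proof.
move=> /infinite_natP infD.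
have /choice[g gP] (L : nat) : exists n, D n /\ (L <= n)%N.
  by have [n] := infD L; exists n.
pose e := fix e k := if k is k'.+1 then g (maxn (e k').+1 (N k)) else g (N 0%N).
exists e; split.
- apply: homo_ltn => [? ? ?|k]; first exact: ltn_trans.
  exact: leq_trans (leq_maxl _ _) (proj2 (gP (maxn (e k).+1 (N k.+1)))).
- by case=> [|k]; [exact: (proj1 (gP _))|exact: (proj1 (gP (maxn (e k).+1 (N k.+1))))].
- case=> [|k]; first exact: (proj2 (gP _)).
  exact: leq_trans (leq_maxr _ _) (proj2 (gP (maxn (e k).+1 (N k.+1)))).
Qed.

Lemma range_seqP (e : nat -> nat) (s : seq nat) : uniq s ->
  (forall i, i \in s -> range e i) -> exists2 F : seq nat, uniq F & s = map e F.
Proof.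
move=> us sr.
have /choice[g gP] n : exists j, range e n -> e j = n.
  have [[j _ <-]|nr] := pselect (range e n); first by exists j.
  by exists 0%N.
have sE : s = map e (map g s).
  rewrite -map_comp -[LHS]map_id; apply/eq_in_map => i /sr/gP gi.
  by rewrite /= gi.
by exists (map g s) => //; apply: (@map_uniq _ _ e); rewrite -sE.
Qed.

Lemma infinite_range (e : nat -> nat) :
  {homo e : i j / (i < j)%N} -> infinite_set (range e).
Proof.
move=> me; apply/infinite_natP => N; exists (e N); first by exists N.
by elim: N => // N /leq_ltn_trans; apply; exact: me.
Qed.

(** Removing a finite set from [D] corresponds to requiring all indices to be at least [k]; thinning
    [D] so that [e k] passes the threshold for [rate k] secures the rate. *)
Lemma FS_limits_sum (X : topologicalType) (d : X -> X -> Rdefinitions.R)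
    (y : nat -> X) : is_metric d -> metric_generates_topology d ->
  FS_limits y = sum_limits d y (fun F k =>
    [/\ uniq F, F != [::] & forall i, i \in F -> (k <= i)%N]).
Proof.
move=> md dtop; have nb := nbhs_metricP md dtop.
have [d_ge0 [d0 [dC dT]]] := md.
apply/seteqP; split=> eta.
  move=> [D [infD Deta]].
  have /choice[N NP] k : exists N, forall n, FS (D `\` `I_N) n ->
      (d eta (y n) < rate k)%R.
    have /Deta[K [/finite_natP[N KN] KU]] :
        nbhs eta [set x | (d eta x < rate k)%R].
      by apply/nb; exists (rate k) => //; exact: rate_gt0.
    exists N => n nN; apply: KU; apply: FS_subset nN => i [Di iN]; split=> //.
    by move=> /KN.
  have [e [me eD eN]] := thin_subsequence N infD.
  exists e => // k F [uF F0 Fk]; rewrite dC; apply/ltW/NP.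
  exists (map e F); split.
  - rewrite map_inj_uniq//; exact: (incn_inj (leq_mono me)).
  - by case: F F0 {uF Fk}.
  - move=> _ /mapP[i /Fk ki ->]; split=> //=; apply/negP; rewrite -leqNgt.
    by apply: leq_trans (eN k) _; rewrite (leq_mono me).
  - by rewrite big_map.
move=> [e me re]; exists (range e); split; first exact: infinite_range.
move=> U /nb[r r0 rU]; have [k kP] := rate_lt r0.
exists `I_(e k); split; first exact: finite_II.
move=> n [s [us s0 sD ->]]; apply: rU => /=.
have [|F uF sE] := @range_seqP e s us; first by move=> i /sD[].
rewrite dC sE big_map; apply: le_lt_trans kP; apply: re; split=> //.
  by rewrite -size_eq0 -(size_map e) -sE size_eq0.
move=> i iF; rewrite -(leq_mono me) leqNgt; apply/negP => ik.
by have [|_ []] := sD (e i); first by rewrite sE map_f.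
Qed.

(** Here finitely many sums are discarded instead of generators, so one index at least [k] suffices:
    it makes the sum at least [e k]. *)
Lemma H_limits_sum (X : topologicalType) (d : X -> X -> Rdefinitions.R)
    (y : nat -> X) : is_metric d -> metric_generates_topology d ->
  H_limits y = sum_limits d y (fun F k =>
    uniq F /\ exists2 i, i \in F & (k <= i)%N).
Proof.
move=> md dtop; have nb := nbhs_metricP md dtop.
have [d_ge0 [d0 [dC dT]]] := md.
apply/seteqP; split=> eta.
  move=> [E [/contrapT[D [infD DE]] Eeta]].
  have /choice[N NP] k : exists N, forall n, FS D n -> (N <= n)%N ->
      (d eta (y n) < rate k)%R.
    have /Eeta/finite_natP[N NU] :
        nbhs eta [set x | (d eta x < rate k)%R].
      by apply/nb; exists (rate k) => //; exact: rate_gt0.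
    exists N => n /DE En; rewrite leqNgt => /negP nN.
    by apply: contrapT => far; apply: nN; exact: NU.
  have [e [me eD eN]] := thin_subsequence N infD.
  exists e => // k F [uF [i iF ki]]; rewrite dC; apply/ltW/NP.
    exists (map e F); split.
    - rewrite map_inj_uniq//; exact: (incn_inj (leq_mono me)).
    - by case: F iF {uF}.
    - by move=> _ /mapP[j _ ->].
    - by rewrite big_map.
  apply: leq_trans (eN k) _; apply: (@leq_trans (e i)); first by rewrite (leq_mono me).
  by rewrite (big_rem _ iF) /= leq_addr.
move=> [e me re]; exists (FS (range e)); split.
  by move=> nIP; apply: nIP; exists (range e); split=> //; exact: infinite_range.
move=> U /nb[r r0 rU]; have [k kP] := rate_lt r0.
(* A sum violating the bound uses only indices below [k], so it is at most the sum of all those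
   terms. *)
apply/finite_natP; exists (\sum_(i <- iota 0 k) e i).+1 => n [[s [us s0 sD ->]] nU].
have [F uF sE] := @range_seqP e s us sD; move: nU; rewrite sE big_map => nU.
rewrite ltnS; apply: uniq_sub_le_big => //.
- by move=> ? ?; exact: leq_addr.
- exact: iota_uniq.
- move=> i iF; rewrite mem_iota /= add0n ltnNge; apply/negP => ki; apply: nU.
  apply: rU => /=; rewrite dC; apply: le_lt_trans kP; apply: re; split=> //.
  by exists i.
Qed.

(** * Equality of the limit families with the analytic sets *)

Lemma H_limits_sub_FS_limits (X : topologicalType) (y : nat -> X) :
  H_limits y `<=` FS_limits y.
Proof.
move=> eta [E [/contrapT[D [infD DE]] Eeta]]; exists D; split=> // U.
move=> /Eeta/finite_natP[N NU]; exists `I_N; split; first exact: finite_II.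
move=> n nN; apply: contrapT => nU; have := FS_ge nN; rewrite leqNgt NU//.
by split=> //; apply: DE; apply: FS_subset nN => i [].
Qed.

Theorem theorem4p3 (X : topologicalType) :
  polish_space X -> ~ countable [set: X] ->
  [/\ L_FS X = Sigma11 X, L_H X = Sigma11 X &
      forall C : set X, analytic C -> C !=set0 ->
        exists y : nat -> X, C = FS_limits y /\ C = H_limits y].
Proof.
move=> [_ [d [md dtop dcomp]]] _.
have repr (C : set X) : analytic C -> C !=set0 ->
    exists y : nat -> X, C = FS_limits y /\ C = H_limits y.
  move=> [->|[f [cf <-]]] C0; first by case: C0.
  (* A cycle of inclusions: [H_limits] in [FS_limits] in [range f] in [H_limits]. *)
  have HF := @H_limits_sub_FS_limits _ (coded_seq f).
  have FC := FS_limits_coded_seq (metric_hausdorff md dtop) cf.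
  have CH : range f `<=` H_limits (coded_seq f).
    by move=> _ [x _ <-]; exact: H_limits_coded_seq.
  exists (coded_seq f); split; apply/seteqP; split=> //.
    exact: subset_trans HF.
  exact: subset_trans FC.
split=> //; apply/seteqP; split=> A.
- move=> [[y ->]|->]; last by left.
  rewrite (FS_limits_sum y md dtop); apply: analytic_sum_limits => // k j kj.
  by split=> // i; rewrite inE => /eqP ->.
- move=> aA; have [A0|/set0P A0] := eqVneq A set0; first by right.
  by have [y [yA _]] := repr _ aA A0; left; exists y.
- move=> [[y ->]|->]; last by left.
  rewrite (H_limits_sum y md dtop); apply: analytic_sum_limits => // k j kj.
  by split=> //; exists j; rewrite ?inE.
- move=> aA; have [A0|/set0P A0] := eqVneq A set0; first by right.
  by have [y [_ yA]] := repr _ aA A0; left; exists y.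
Qed.
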